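(* Let $c<1/2$ and $\epsilon>0$. Then there exists $n_0$ such that $$\mathbb{P}_{n}\bigl(|V_{t}(\kappa n)| = 0\bigr) > 1 - \epsilon\, \kappa^{-3/2}$$ for all $t \le c N$ (where $N=2^n$), all $\kappa\ge \frac{2\ln 2}{(1-2c)^2}$, and all $n>n_{0}$.
   Context: For $n\in\mathbb{N}$ let $G_n=(Q_n,E_n)$ be the hypercube graph: $Q_n=\{0,1\}^n$ has $N=2^n$ vertices, and $E_n$ consists of the pairs of vertices differing in exactly one coordinate, so $|E_n|=Nn/2$. Edges $e_1,e_2,e_3,\dots$ are chosen independently and uniformly at random from $E_n$; $\mathbb{P}_n$ denotes the corresponding probability. For an edge $e$ let $\tau_e$ be the transposition of its two endvertices, and let $\sigma_t=\tau_{e_t}\circ\tau_{e_{t-1}}\circ\cdots\circ\tau_{e_1}$, a random permutation of $Q_n$ (with $t$ a nonnegative integer; $\sigma_0$ is the identity). For a real number $\ell>0$, $V_t(\ell)\subset Q_n$ is the random set of vertices that belong to cycles of $\sigma_t$ of length greater than $\ell$. $\ln$ is the natural logarithm. *)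

(* Defs.v *)
From HB Require Import structures.
From mathcomp Require Import all_boot all_order all_algebra all_fingroup.
From mathcomp Require Import reals exp.

Set Implicit Arguments.
Unset Strict Implicit.
Unset Printing Implicit Defensive.

Import Order.TTheory GRing.Theory Num.Theory.

Definition cube (n : nat) : finType := {ffun 'I_n -> bool}.

Definition adjacent (n : nat) (x y : cube n) : bool :=
  #|[set i : 'I_n | x i != y i]| == 1.

Definition edge_set (n : nat) : {set {set cube n}} :=
  [set e | [exists x : cube n, exists y : cube n,
              adjacent x y && (e == [set x; y])]].

Definition edge (n : nat) : finType := {e : {set cube n} | e \in edge_set n}.

(* Every edge has exactly two elements, so the default case never occurs. *)
Definition edge_tperm (n : nat) (e : edge n) : {perm cube n} :=
  if enum (val e) is [:: x; y] then tperm x y else 1%g.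

(* In {perm T} the product s * u applies s first, so the transposition of the
   first edge of w acts first: this is tau_(e_t) \o ... \o tau_(e_1). *)
Definition sigma (n t : nat) (w : t.-tuple (edge n)) : {perm cube n} :=
  (\prod_(e <- w) edge_tperm e)%g.

Local Open Scope ring_scope.

Definition long_cycle_vertices (R : realType) (n : nat) (s : {perm cube n})
    (l : R) : {set cube n} :=
  [set x | l < #|porbit s x|%:R].

(* Law of the first t of a sequence of independent uniform edges: the t-fold
   product of the uniform distribution on the edges.  An event about sigma_t
   depends on these t edges only. *)
Definition Pr (R : realType) (n t : nat) (A : pred (t.-tuple (edge n))) : R :=
  \sum_(w : t.-tuple (edge n) | A w) \prod_(i < t) #|edge n|%:R^-1.

(* Main.v *)
Require Import Defs.
From mathcomp Require Import all_boot all_order all_algebra all_fingroup.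
From mathcomp Require Import reals topology normedtype sequences derive exp.
From mathcomp Require Import zify ring lra.

(** A cycle of [sigma w] never leaves a set of vertices that no edge of [w]
crosses, so a vertex on a cycle of length greater than [m] lies in a connected
component, of the graph formed by the edges of [w], with more than [m]
vertices.  Such components are ruled out by a first-moment bound.

Explore the component of a vertex [v] by querying, one at a time, edges that
cross the boundary of the set of vertices found so far.  A query succeeds when
the edge occurs in [w].  The exploration has found [m + 1] vertices after [m]
successes, and up to then it queries at most [m * n] edges, the cube having
degree [n].  Edges drawn with replacement satisfy
  Pr(w covers A and avoids B) <= p ^ #|A| * q ^ #|B|
with [p] close to [t / #|edge n|] and [q = exp(- t / #|edge n|)]
([card_cover_avoid], [card_cover_avoid_product]).  The exploration is thus
dominated by independent trials with weights [p] and [q], and Chernoff's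
exponential weighting with a parameter [z >= 1] gives
  Pr(v is on a cycle longer than m) <= z ^ - m * (z * p + q) ^ (m * n)
([card_long_cycle_explore], [card_long_cycle]).

For [t <= c N] the mean number of successes per found vertex is at most
[2 * c = 1 - x], where [x = 1 - 2 * c].  The choice [z = e ^ x] turns the bound
into [exp (- m * (cycle_rate x - O(1 / n)))] with
[cycle_rate x = 1 - (1 - x) * e ^ x] ([Pr_long_cycle_exp]).  The crux is that
[cycle_rate x] strictly exceeds [x ^ 2 / 2] ([cycle_rate_gt]).  Summing over the
[2 ^ n] vertices and taking [m] about [kappa * n], the hypothesis
[kappa * x ^ 2 / 2 >= ln 2] makes [exp (- m * x ^ 2 / 2)] absorb the factor
[2 ^ n], while the excess [delta] of the rate leaves [exp (- delta * kappa * n)].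
That is far below [eps * kappa ^ (- 3 / 2)] for large [n], uniformly in
[kappa]. *)

Set Implicit Arguments.
Unset Strict Implicit.
Unset Printing Implicit Defensive.
Import Order.TTheory GRing.Theory Num.Theory.
Import numFieldNormedType.Exports.

(** * Random words that cover one set and avoid another *)

Lemma leq_addn_expS (t a : nat) : a * t ^ a.-1 + t ^ a <= t.+1 ^ a.
Proof.
case: a => [|a] /=; first by rewrite mul0n.
elim: a => [|a IHa]; first by rewrite !expn1 expn0 mul1n.
rewrite [t.+1 ^ _]expnS; apply: leq_trans (leq_mul (leqnn t.+1) IHa).
by rewrite /= !expnS; move: (t ^ a) => x; nia.
Qed.

(** Choosing positions for the letters of [A] in [t ^ #|A|] ways and filling the
others outside [B] suggests the bound [t ^ #|A| * (#|T| - #|B|) ^ (t - #|A|)].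
Moving the power of [#|T| - #|B|] to the left avoids the subtraction in the
exponent, so that the bound is meaningful also for [t < #|A|]. *)
Lemma card_cover_avoid (T : finType) (t : nat) (A B : {set T}) :
  #|[set w : t.-tuple T | (A \subset w) && [disjoint B & w]]|
    * (#|T| - #|B|) ^ #|A| <= t ^ #|A| * (#|T| - #|B|) ^ t.
Proof.
set u := #|T| - #|B|.
elim: t A => [|t IHt] A.
  have [->|A0] := eqVneq A set0.
    by rewrite cards0 !expn0 !muln1 -(expn0 #|T|) -card_tuple max_card.
  rewrite [X in X * _](_ : _ = 0) ?mul0n //.
  apply/eqP; rewrite cards_eq0; apply/eqP/setP=> w; rewrite !inE tuple0.
  by apply: contraNF A0 => /andP[/subset_leq_card]; rewrite card0 leqn0 cards_eq0.
(* The first letter [e] lies outside [B], and the rest must cover [A :\ e]. *)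
pose N (C : {set T}) := #|[set w : t.-tuple T | (C \subset w) && [disjoint B & w]]|.
have first_letter : #|[set w : t.+1.-tuple T | (A \subset w) && [disjoint B & w]]|
    <= \sum_(e in ~: B) N (A :\ e).
  rewrite -sum1_card (partition_big (fun w : t.+1.-tuple T => thead w) (mem (~: B))) /=.
    apply: leq_sum => e _.
    rewrite (eq_bigl [in [set w : t.+1.-tuple T |
      [&& A \subset w, [disjoint B & w] & thead w == e]]]); last first.
      by move=> w; rewrite !inE andbA.
    rewrite sum1_card.
    apply: leq_trans (leq_imset_card (cons_tuple e) _).
    apply/subset_leq_card/subsetP => w; rewrite inE => /and3P[Aw Bw /eqP we].
    apply/imsetP; exists (behead_tuple w); last first.
      by rewrite -we; apply: val_inj => /=; case/tupleP: w {Aw Bw we}.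
    case/tupleP: w Aw Bw we => x w; rewrite theadE => Aw Bw <-.
    rewrite inE; apply/andP; split.
      apply/subsetP => y; rewrite !inE => /andP[yx yA].
      by have := subsetP Aw y yA; rewrite !inE (negPf yx).
    apply: disjointWr Bw; apply/subsetP => y yw.
    exact: mem_behead yw.
  move=> w; rewrite !inE => /andP[_]; rewrite disjoint_sym.
  by move=> /disjointFr -> //; rewrite mem_tnth.
apply: leq_trans (leq_mul first_letter (leqnn _)) _.
rewrite big_distrl /=.
apply: (@leq_trans (\sum_(e in ~: B)
   (u ^ t * ((if e \in A then u * t ^ #|A|.-1 else 0) + t ^ #|A|)))).
  apply: leq_sum => e _; have := IHt (A :\ e).
  rewrite -/(N (A :\ e)).
  have [eA|eA] := boolP (e \in A).
    rewrite (cardsD1 e A) eA add1n /=.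
    rewrite expnS mulnCA => /(leq_mul (leqnn u)) /leq_trans; apply.
    by rewrite mulnDr [t ^ _ * _]mulnC mulnCA leq_addr.
  rewrite (_ : A :\ e = A).
    by rewrite add0n [u ^ t * _]mulnC.
  by apply/setP=> z; rewrite !inE; case: eqP => // ->; rewrite (negPf eA).
rewrite -big_distrr /= big_split /= sum_nat_const.
have cu : #|~: B| = u by rewrite cardsCs setCK.
rewrite cu -big_mkcondr /=.
apply: (@leq_trans (u ^ t * (#|A| * (u * t ^ #|A|.-1) + u * t ^ #|A|))).
  rewrite leq_mul2l leq_add2r -sum_nat_const big_mkcond [X in _ <= X]big_mkcond /=.
  apply/orP; right; apply: leq_sum => e _.
  by case: (e \in A); rewrite ?andbT ?andbF //; case: ifP.
rewrite mulnCA -mulnDr mulnA -expnSr mulnC leq_mul2r leq_addn_expS orbT //.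
Qed.

(** * Exploring a component in a graph of bounded degree *)

Lemma porbit_sub_closed (V E : finType) (act : E -> {perm V}) (w : seq E)
    (S : {set V}) (v : V) :
  {in w, forall e, {in S, forall x, act e x \in S}} -> v \in S ->
  porbit (\prod_(e <- w) act e)%g v \subset S.
Proof.
move=> actS vS.
have prodS : {in S, forall x, (\prod_(e <- w) act e)%g x \in S}.
  elim: w actS => [|e w IHw] actS x xS; first by rewrite big_nil perm1.
  rewrite big_cons permM IHw ?actS ?mem_head // => f fw y yS.
  by apply: actS; rewrite // inE fw orbT.
apply/subsetP => _ /porbitP[i ->]; elim: i => [|i IHi].
  by rewrite expg0 perm1.
by rewrite expgSr permM prodS.
Qed.

Local Open Scope ring_scope.

(** The probability of covering [A] and avoiding [B] is dominated by a product
of weights, one per queried edge, as for independent queries.  Reserving [L]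
for the size of [B] gives every success the same weight. *)
Lemma card_cover_avoid_product (R : realType) (T : finType) (t L : nat)
    (A B : {set T}) :
  (#|B| <= L < #|T|)%N ->
  #|[set w : t.-tuple T | (A \subset w) && [disjoint B & w]]|%:R
    <= #|T|%:R ^+ t * ((t%:R / (#|T| - L)%:R) ^+ #|A|
         * expR (- (t%:R / #|T|%:R)) ^+ #|B|) :> R.
Proof.
move=> /andP[BL LT]; have T0 : (0 < #|T|)%N by exact: leq_ltn_trans LT.
have := card_cover_avoid t A B; set N := #|_|; set u := (#|T| - #|B|)%N => Nu.
have u0 : 0 < u%:R :> R by rewrite ltr0n subn_gt0 (leq_ltn_trans BL).
have Lu : (#|T| - L <= u)%N by rewrite leq_sub2l.
have L0 : 0 < (#|T| - L)%:R :> R by rewrite ltr0n subn_gt0.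
have TR0 : 0 < #|T|%:R :> R by rewrite ltr0n.
apply: (@le_trans _ _ ((t%:R / u%:R) ^+ #|A| * u%:R ^+ t)).
  by rewrite expr_div_n mulrAC ler_pdivlMr ?exprn_gt0 // -!natrX -!natrM ler_nat.
rewrite mulrCA ler_pM ?exprn_ge0 ?divr_ge0 ?ler0n //.
  rewrite lerXn2r ?nnegrE ?divr_ge0 ?ler0n //.
  by rewrite ler_wpM2l ?ler0n // lef_pV2 ?posrE // ler_nat.
rewrite -expRM_natl mulrN mulrCA -mulrN expRM_natl -exprMn.
rewrite lerXn2r ?nnegrE ?mulr_ge0 ?expR_ge0 ?ler0n //.
rewrite natrB ?max_card // mulrC -ler_pdivrMr // mulrBl divff ?gt_eqF //.
exact: expR_ge1Dx.
Qed.

(** State of the exploration: [S] is the set of vertices found, [A] the queried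
edges that occur in [w] and [B] those that do not; [r] queries remain in the
budget [m * d].  Each success finds one new vertex, whence [#|S| = #|A|.+1].
The bound is the weight [p ^ #|A| * q ^ #|B|] of the state times a Chernoff
estimate for reaching [m] successes within [r] further queries.  It is an exact
martingale, as a query replaces the last factor [z * p + q] by the two
alternatives [z * p] and [q]. *)
Lemma card_long_cycle_explore (R : realType) (V E : finType) (ends : E -> {set V})
    (act : E -> {perm V}) (d m t : nat) (z : R) (v : V) :
  (forall e, #|ends e| = 2) -> (forall e, perm_on (ends e) (act e)) ->
  (forall x, (#|[set e | x \in ends e]| <= d)%N) -> (m * d < #|E|)%N -> 1 <= z ->
  let p := t%:R / (#|E| - m * d)%:R in
  let q := expR (- (t%:R / #|E|%:R)) in
  forall (r : nat) (S : {set V}) (A B : {set E}),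
    v \in S -> #|S| = #|A|.+1 -> (#|A| <= m)%N ->
    {in A, forall e, ends e \subset S} ->
    {in B, forall e, ~~ [disjoint ends e & S]} -> [disjoint A & B] ->
    (r + (#|A| + #|B|) = m * d)%N ->
    #|[set w : t.-tuple E | [&& A \subset w, [disjoint B & w] &
         (m < #|porbit (\prod_(e <- w) act e)%g v|)%N]]|%:R
    <= #|E|%:R ^+ t * (p ^+ #|A| * q ^+ #|B| * z ^- (m - #|A|) * (z * p + q) ^+ r).
Proof.
move=> ends2 act_ends deg mdE z1 p q.
have E0 : (0 < #|E|)%N by exact: leq_ltn_trans mdE.
have ER0 : 0 < #|E|%:R :> R by rewrite ltr0n.
have z0 : 0 < z by exact: lt_le_trans z1.
have p0 : 0 <= p by rewrite divr_ge0 ?ler0n.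
have q0 : 0 <= q by exact: expR_ge0.
have zpq1 : 1 <= z * p + q.
  apply: (@le_trans _ _ (t%:R / #|E|%:R + (1 - t%:R / #|E|%:R))); first by rewrite addrC subrK.
  apply: lerD; last exact: expR_ge1Dx.
  apply: (@le_trans _ _ p); last by rewrite ler_peMl.
  rewrite ler_wpM2l ?ler0n // lef_pV2 ?posrE ?ltr0n ?subn_gt0 //.
  by rewrite ler_nat leq_subr.
have zp0 : 0 <= z * p + q by exact: le_trans zpq1.
have M0 : 0 <= #|E|%:R ^+ t :> R by rewrite exprn_ge0 ?ler0n.
(* Once [m] vertices besides [v] are found, the cycle condition is dropped. *)
have full r (S : {set V}) (A B : {set E}) : #|A| = m -> (#|B| <= m * d)%N ->
    #|[set w : t.-tuple E | [&& A \subset w, [disjoint B & w] &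
         (m < #|porbit (\prod_(e <- w) act e)%g v|)%N]]|%:R
    <= #|E|%:R ^+ t * (p ^+ #|A| * q ^+ #|B| * z ^- (m - #|A|) * (z * p + q) ^+ r).
  move=> Am Bmd; rewrite {2}Am subnn expr0 invr1 mulr1.
  apply: (@le_trans _ _ (#|E|%:R ^+ t * (p ^+ #|A| * q ^+ #|B|))).
    apply: le_trans (card_cover_avoid_product R t A (L := m * d) (B := B) _); last by rewrite Bmd.
    rewrite ler_nat; apply/subset_leq_card/subsetP => w; rewrite !inE.
    by move=> /and3P[-> ->].
  by rewrite ler_wpM2l // ler_peMr ?mulr_ge0 ?exprn_ge0 // exprn_ege1.
(* Double counting of the pairs of an edge of [C] and an end of it in [S]. *)
have touched (S : {set V}) (C : {set E}) :
    {in C, forall e, ~~ [disjoint ends e & S]} -> (#|C| <= #|S| * d)%N.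
  move=> CS; rewrite -sum1_card -sum_nat_const.
  apply: (@leq_trans (\sum_(e in C) \sum_(x in S) (x \in ends e))).
    apply: leq_sum => e /CS; rewrite -setI_eq0 => /set0Pn[x].
    by rewrite inE => /andP[xe xS]; rewrite (bigD1 x) //= xe.
  rewrite exchange_big /=; apply: leq_sum => x _; apply: leq_trans (deg x).
  rewrite -sum1dep_card big_mkcond [X in (_ <= X)%N]big_mkcond /=.
  by apply: leq_sum => e _; do 2 case: ifP.
(* With no boundary edge left to query, the cycle of [v] is confined to [S]. *)
have stuck (S : {set V}) (A B : {set E}) : v \in S -> (#|S| <= m)%N ->
    (forall e, ~~ (ends e \subset S) -> ~~ [disjoint ends e & S] -> e \in B) ->
    [set w : t.-tuple E | [&& A \subset w, [disjoint B & w] &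
         (m < #|porbit (\prod_(e <- w) act e)%g v|)%N]] = set0.
  move=> vS Sm bdry; apply/setP => w; rewrite !inE; apply/and3P => -[_ Bw].
  rewrite ltnNge => /negP; apply; apply: leq_trans Sm; apply: subset_leq_card.
  apply: porbit_sub_closed vS => e ew x xS.
  have [xe|xe] := boolP (x \in ends e); last by rewrite (out_perm (act_ends e)).
  have [/subsetP eS|eS] := boolP (ends e \subset S).
    by rewrite eS // perm_closed.
  have eB : e \in B.
    by apply: bdry => //; rewrite -setI_eq0; apply/set0Pn; exists x; rewrite inE xe.
  by rewrite (disjointFr Bw eB) in ew.
(* All queried edges, the next one included, touch at most [m] vertices, so the
   budget is not exhausted. *)
have room (S : {set V}) (A B : {set E}) e :
    #|S| = #|A|.+1 -> (#|A| < m)%N -> {in A, forall e, ends e \subset S} ->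
    {in B, forall e, ~~ [disjoint ends e & S]} -> [disjoint A & B] ->
    ~~ (ends e \subset S) -> ~~ [disjoint ends e & S] -> e \notin B ->
    (#|A| + #|B| < m * d)%N.
  move=> cS Am AS BS AB eS enS eB.
  have eA : e \notin A by apply: contra eS => /AS.
  have -> : (#|A| + #|B|).+1 = #|e |: (A :|: B)|.
    by rewrite cardsU1 inE negb_or eA eB cardsU (disjoint_setI0 AB) cards0 subn0.
  apply: (@leq_trans (#|S| * d)%N); last by rewrite leq_mul2r cS Am orbT.
  apply: touched => f; rewrite !inE => /or3P[/eqP -> //|fA|]; last exact: BS.
  have := AS f fA; rewrite -setI_eq0 => /setIidPl ->.
  by rewrite -cards_eq0 ends2.
elim=> [|r IHr] S A B vS cS Am AS BS AB rE; have Bmd : (#|B| <= m * d)%N by rewrite -rE addnA leq_addl.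
- have [mA|Alt] := leqP m #|A|.
    by apply: full => //; apply/eqP; rewrite eqn_leq Am.
  rewrite (@stuck S) ?cS // ?cards0 ?mulr_ge0 ?exprn_ge0 ?invr_ge0 ?exprn_ge0 ?(ltW z0) //.
  move=> e eS enS; apply/negPn/negP => eB.
  by have := room S A B e cS Alt AS BS AB eS enS eB; rewrite -rE add0n ltnn.
have [mA|Alt] := leqP m #|A|.
  by apply: full => //; apply/eqP; rewrite eqn_leq Am.
have [/existsP[e /and3P[eS enS eB]]|none] := boolP [exists e,
    [&& ~~ (ends e \subset S), ~~ [disjoint ends e & S] & e \notin B]]; last first.
  rewrite (@stuck S) ?cS // ?cards0 ?mulr_ge0 ?exprn_ge0 ?invr_ge0 ?exprn_ge0 ?(ltW z0) //.
  move=> e eS enS; apply: contraNT none => eB.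
  by apply/existsP; exists e; rewrite eS enS.
have eA : e \notin A by apply: contra eS => /AS.
have cU : #|S :|: ends e| = #|e |: A|.+1.
  have [x xe xS] : exists2 x, x \in ends e & x \in S.
    by move: enS; rewrite -setI_eq0 => /set0Pn[x]; rewrite inE => /andP[]; exists x.
  have [y ye yS] := subsetPn eS.
  have xy : x != y by apply: contraNneq yS => <-.
  have -> : ends e = [set x; y].
    apply/esym/eqP; rewrite eqEcard ends2 cards2 xy andbT.
    by apply/subsetP => u; rewrite !inE => /orP[] /eqP ->.
  rewrite setUA [S :|: _](setUidPl _) ?sub1set //.
  by rewrite setUC cardsU1 yS cS cardsU1 eA.
(* The two terms are the bounds after [e] is found in [w] and after it is not. *)
have split_e : #|E|%:R ^+ t *
      (p ^+ #|A| * q ^+ #|B| * z ^- (m - #|A|) * (z * p + q) ^+ r.+1) =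
    #|E|%:R ^+ t * (p ^+ #|e |: A| * q ^+ #|B| * z ^- (m - #|e |: A|) * (z * p + q) ^+ r)
    + #|E|%:R ^+ t * (p ^+ #|A| * q ^+ #|e |: B| * z ^- (m - #|A|) * (z * p + q) ^+ r).
  have mAS : (m - #|A| = (m - #|A|.+1).+1)%N by rewrite -subSn ?subSS.
  rewrite !cardsU1 eA eB !add1n mAS -mulrDr; congr (_ * _).
  have -> : z ^- (m - #|A|.+1) = z ^- (m - #|A|.+1).+1 * z.
    by rewrite exprSr invfM mulfVK ?gt_eqF.
  move: (z ^- _) => iz; rewrite !exprS; move: (p ^+ _) (q ^+ _) (_ ^+ r) => pa qb s.
  by ring.
rewrite split_e.
have disjU1 (C : {pred E}) (D : {set E}) :
    [disjoint e |: D & C] = (e \notin C) && [disjoint D & C].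
  by rewrite -disjointU1; apply: eq_disjoint => f; rewrite !inE.
have ABe : [disjoint e |: A & B] by rewrite disjU1 eB.
have AeB : [disjoint A & e |: B] by rewrite disjoint_sym disjU1 eA disjoint_sym.
apply: le_trans (lerD (IHr (S :|: ends e) (e |: A) B _ _ _ _ _ _ _)
                      (IHr S A (e |: B) _ _ _ _ _ _ _)) => //.
- rewrite -natrD ler_nat; apply: leq_trans (leq_card_setU _ _).
  apply/subset_leq_card/subsetP => w; rewrite !inE => /and3P[Aw Bw ->].
  rewrite Aw Bw disjU1 Bw !andbT /=; case: (boolP (e \in w)) => ew; last by rewrite orbT.
  rewrite orbF.
  by apply/subsetP => f; rewrite !inE => /orP[/eqP -> //|/(subsetP Aw)].
- by rewrite inE vS.
- by rewrite cardsU1 eA.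
- by move=> f; rewrite !inE => /orP[/eqP ->|/AS fS]; rewrite ?subsetUr // subsetU ?fS.
- move=> f /BS; rewrite -!setI_eq0 => /set0Pn[x xfS]; apply/set0Pn; exists x.
  by move: xfS; rewrite !inE => /andP[-> ->].
- by rewrite cardsU1 eA add1n -rE addSn addnS addSn.
- by move=> f; rewrite !inE => /orP[/eqP ->|/BS].
- by rewrite cardsU1 eB add1n -rE !addnS addSn.
Qed.

(** The exploration started from [v] alone, with nothing queried. *)
Lemma card_long_cycle (R : realType) (V E : finType) (ends : E -> {set V})
    (act : E -> {perm V}) (d m t : nat) (z : R) (v : V) :
  (forall e, #|ends e| = 2) -> (forall e, perm_on (ends e) (act e)) ->
  (forall x, (#|[set e | x \in ends e]| <= d)%N) -> (m * d < #|E|)%N -> 1 <= z ->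
  #|[set w : t.-tuple E | (m < #|porbit (\prod_(e <- w) act e)%g v|)%N]|%:R
    <= #|E|%:R ^+ t * (z ^- m * (z * (t%:R / (#|E| - m * d)%:R)
                                 + expR (- (t%:R / #|E|%:R))) ^+ (m * d)).
Proof.
move=> ends2 act_ends deg mdE z1.
have := @card_long_cycle_explore R V E ends act d m t z v ends2 act_ends deg mdE z1 (m * d)
  [set v] set0 set0.
rewrite !cards0 cards1 subn0 !expr0 !mul1r => bound.
apply: le_trans (bound _ _ _ _ _ _ _); rewrite ?set11 ?addn0 //.
- rewrite ler_nat; apply/subset_leq_card/subsetP => w; rewrite !inE => ->.
  by rewrite andbT disjoint_subset; apply/andP; split; apply/subsetP => e; rewrite inE.
- by move=> e; rewrite inE.
- by move=> e; rewrite inE.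
- by rewrite -setI_eq0 setI0.
Qed.

(** * Edges of the hypercube *)

Local Open Scope nat_scope.

Definition flip (n : nat) (x : cube n) (i : 'I_n) : cube n :=
  [ffun j => x j (+) (j == i)].

Lemma flip_neq (n : nat) (x : cube n) (i j : 'I_n) : (x j != flip x i j) = (j == i).
Proof. by rewrite ffunE; case: (x j); case: (j == i). Qed.

Lemma flip_inj (n : nat) (x : cube n) : injective (flip x).
Proof.
move=> i j /ffunP/(_ i); rewrite !ffunE eqxx => /addbI/esym ij.
exact/eqP.
Qed.

Lemma adjacentP (n : nat) (x y : cube n) :
  reflect (exists i, y = flip x i) (Defs.adjacent x y).
Proof.
apply: (iffP cards1P) => -[i xi]; exists i.
  apply/ffunP => j; move/setP: xi => /(_ j); rewrite !inE ffunE.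
  by case: (x j); case: (y j) => /= <-.
by apply/setP => j; rewrite !inE xi flip_neq.
Qed.

Lemma edge_setP (n : nat) (e : {set cube n}) :
  reflect (exists x i, e = [set x; flip x i]) (e \in edge_set n).
Proof.
rewrite inE; apply: (iffP existsP) => [[x /existsP[y]]|[x [i ->]]].
  by case/andP => /adjacentP[i ->] /eqP ->; exists x, i.
exists x; apply/existsP; exists (flip x i); rewrite eqxx andbT.
by apply/adjacentP; exists i.
Qed.

Lemma flip_neq_id (n : nat) (x : cube n) (i : 'I_n) : x != flip x i.
Proof. by apply/eqP => /ffunP/(_ i)/eqP; apply/negP; rewrite flip_neq. Qed.

Lemma flipK (n : nat) (x : cube n) (i : 'I_n) : flip (flip x i) i = x.
Proof. by apply/ffunP => j; rewrite !ffunE -addbA addbb addbF. Qed.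

Lemma card_edge_ends (n : nat) (e : edge n) : #|val e| = 2.
Proof. by have /edge_setP[x [i ->]] := valP e; rewrite cards2 flip_neq_id. Qed.

Lemma edge_tperm_on (n : nat) (e : edge n) : perm_on (val e) (edge_tperm e).
Proof.
rewrite /edge_tperm; case Ee: (enum (val e)) => [|x [|y [|? ?]]]; try exact: perm_on1.
apply: subset_trans (tperm_on x y) _.
by apply/subsetP => z; rewrite !inE -[z \in val e]mem_enum Ee !inE.
Qed.

Lemma card_incident_edges (n : nat) (x : cube n) :
  #|[set e : edge n | x \in val e]| = n.
Proof.
have edge_inj : injective (fun i : 'I_n => [set x; flip x i]).
  move=> i j /setP/(_ (flip x i)); rewrite !inE eqxx orbT eq_sym.
  by rewrite (negPf (flip_neq_id x i)) /= => /esym/eqP/flip_inj.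
rewrite -(card_imset _ val_inj) -[RHS]card_ord -cardsT -(card_imset _ edge_inj).
congr #|pred_of_set _|; apply/setP => e.
apply/imsetP/imsetP => [[f + ->]|[i _ ->]].
  have /edge_setP[y [i fE]] := valP f; rewrite inE fE !inE => /orP[] /eqP ->; exists i => //.
  by rewrite flipK setUC.
have ei : [set x; flip x i] \in edge_set n by apply/edge_setP; exists x, i.
by exists (exist (fun f => f \in edge_set n) _ ei); rewrite ?inE //= ?inE ?eqxx.
Qed.

(** Counting the incident pairs of an edge and a vertex in two ways. *)
Lemma card_edge (n : nat) : 2 * #|edge n| = n * 2 ^ n.
Proof.
rewrite mulnC -sum_nat_const (eq_bigr (fun e : edge n => #|val e|)); last first.
  by move=> e _; rewrite card_edge_ends.
transitivity (\sum_(e : edge n) \sum_(x : cube n) (x \in val e)).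
  by apply: eq_bigr => e _; rewrite -sum1_card big_mkcond.
rewrite exchange_big /= (eq_bigr (fun=> n)); last first.
  by move=> x _; rewrite -[RHS](card_incident_edges x) -sum1dep_card [RHS]big_mkcond.
by rewrite sum_nat_const card_ffun card_bool card_ord mulnC.
Qed.

(** * The first-moment bound on the hypercube *)

Local Open Scope ring_scope.

Lemma PrE (R : realType) (n t : nat) (A : pred (t.-tuple (edge n))) :
  Pr R A = #|[set w | A w]|%:R / #|edge n|%:R ^+ t.
Proof.
rewrite /Pr prodr_const card_ord exprVn sumr_const mulr_natl.
by congr (_ *+ _); apply: eq_card => w; rewrite inE.
Qed.

Lemma Pr_compl (R : realType) (n t : nat) (A : pred (t.-tuple (edge n))) :
  (0 < #|edge n|)%N -> Pr R A = 1 - Pr R (predC A).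
Proof.
move=> M0; rewrite !PrE; apply/eqP; rewrite eq_sym subr_eq -mulrDl -natrD.
have -> : [set w | predC A w] = ~: [set w | A w] by apply/setP => w; rewrite !inE.
by rewrite cardsC card_tuple natrX divff // expf_neq0 // pnatr_eq0 -lt0n.
Qed.

(** Union bound over the vertices.  The assumption [2 * m < 2 ^ n] says that the
query budget [m * n] is smaller than the number of edges. *)
Lemma Pr_long_cycle (R : realType) (n t m : nat) (z l : R) :
  (0 < n)%N -> (2 * m < 2 ^ n)%N -> m%:R <= l -> 1 <= z ->
  Pr R (fun w : t.-tuple (edge n) => #|long_cycle_vertices (sigma w) l| != 0%N)
  <= 2 ^+ n * (z ^- m * (z * (t%:R / (#|edge n| - m * n)%:R)
                         + expR (- (t%:R / #|edge n|%:R))) ^+ (m * n)).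
Proof.
move=> n0 mN ml z1; have M2 := card_edge n.
have mM : (m * n < #|edge n|)%N by nia.
have M0 : 0 < #|edge n|%:R ^+ t :> R by rewrite exprn_gt0 // ltr0n; lia.
rewrite PrE ler_pdivrMr //.
apply: (@le_trans _ _ (\sum_(v : cube n) #|[set w : t.-tuple (edge n) |
    (m < #|porbit (sigma w) v|)%N]|%:R)).
  rewrite -natr_sum ler_nat.
  apply: (@leq_trans (\sum_(w : t.-tuple (edge n)) \sum_(v : cube n)
     (m < #|porbit (sigma w) v|)%N)).
    rewrite -sum1_card big_mkcond; apply: leq_sum => w _; rewrite inE.
    case: ifP => //; rewrite -lt0n => /card_gt0P[v]; rewrite inE => lv.
    rewrite (bigD1 v) //= ltn_addr // lt0b.
    by rewrite -(ltr_nat R) (le_lt_trans ml).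
  rewrite exchange_big /=; apply: leq_sum => v _.
  by rewrite -sum1dep_card [X in (_ <= X)%N]big_mkcond.
apply: (@le_trans _ _ (\sum_(v : cube n) (#|edge n|%:R ^+ t *
   (z ^- m * (z * (t%:R / (#|edge n| - m * n)%:R)
              + expR (- (t%:R / #|edge n|%:R))) ^+ (m * n))))).
  apply: ler_sum => v _; apply: (card_long_cycle (ends := val)) => //.
  - exact: card_edge_ends.
  - exact: edge_tperm_on.
  - by move=> x; rewrite card_incident_edges.
rewrite sumr_const card_ffun card_bool card_ord -[leLHS]mulr_natl natrX.
by rewrite [leLHS]mulrA [leLHS]mulrAC.
Qed.

(** * The exponential rate *)

Lemma expR_half_le2 (R : realType) : expR (1 / 2) <= 2 :> R.
Proof.
rewrite -[X in X <= _]invrK -expRN -[leRHS]invrK lef_pV2 ?posrE ?invr_gt0 ?expR_gt0 //.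
by apply: le_trans (expR_ge1Dx _); lra.
Qed.

Lemma expR1_le4 (R : realType) : expR 1 <= 4 :> R.
Proof.
rewrite (_ : 1 = 1 / 2 + 1 / 2 :> R); last by lra.
have := expR_half_le2 R; have := expR_gt0 (1 / 2 : R).
by rewrite expRD; move: (expR _) => u *; nra.
Qed.

Lemma ln2_ge_half (R : realType) : 1 / 2 <= ln 2 :> R.
Proof. by rewrite -ler_expR lnK ?posrE // expR_half_le2. Qed.

Lemma expRN_le (R : realType) (y : R) : 0 <= y -> expR (- y) <= 1 - y + y ^+ 2.
Proof.
move=> y0; rewrite expRN -[leLHS]mul1r ler_pdivrMr ?expR_gt0 //.
apply: (@le_trans _ _ ((1 - y + y ^+ 2) * (1 + y))); first by nra.
by rewrite ler_wpM2l ?expR_ge1Dx //; nra.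
Qed.

Lemma expn3_le_exp2 (n : nat) : (10 <= n)%N -> (n ^ 3 <= 2 ^ n)%N.
Proof.
elim: n => // n IHn; rewrite leq_eqVlt => /predU1P[<- //|].
rewrite ltnS => n10; rewrite [(2 ^ _)%N]expnS.
apply: leq_trans (leq_mul (leqnn 2) (IHn n10)); rewrite !expnS expn0; nia.
Qed.

(** The Chernoff exponent per vertex [ln z - (1 - x) * (z - 1)] at [z = e ^ x],
where [1 - x] is the mean number of successes per vertex.  The optimal
[z = 1 / (1 - x)] would be infinite for [x = 1], and [e ^ x] loses only terms of
fourth order in [x]. *)
Definition cycle_rate (R : realType) (x : R) : R := 1 - (1 - x) * expR x.

(** The loss [17 / n] covers the three approximations of the weights: [p] exceeds
[y = t / #|edge n|] by the factor [1 / (1 - eta)], where [eta = 2 * m / 2 ^ n] is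
the fraction of edges that may be queried; [q] exceeds [1 - y] by at most
[y ^ 2]; and [m <= n ^ 2] makes [eta <= 2 / n], once [n ^ 3 <= 2 ^ n]. *)
Lemma Pr_long_cycle_exp (R : realType) (n t m : nat) (c l : R) :
  c < 1 / 2 -> (10 <= n)%N -> t%:R <= c * 2 ^+ n -> (m <= n ^ 2)%N -> m%:R <= l ->
  Pr R (fun w : t.-tuple (edge n) => #|long_cycle_vertices (sigma w) l| != 0%N)
  <= 2 ^+ n * expR (- (m%:R * (cycle_rate (1 - 2 * c) - 17 / n%:R))).
Proof.
move=> c2 n10 tc mn ml; set x := 1 - 2 * c.
have n3 := expn3_le_exp2 n10.
have n0 : 10 <= n%:R :> R by rewrite ler_nat.
have mN : (m * n <= 2 ^ n)%N by apply: leq_trans n3; rewrite expnSr leq_mul2r mn orbT.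
have mN2 : (2 * m < 2 ^ n)%N by nia.
have N0 : 0 < 2 ^+ n :> R by rewrite exprn_gt0.
have c0 : 0 <= c by rewrite -(pmulr_lge0 _ N0) (le_trans _ tc) ?ler0n.
have x0 : 0 <= x by rewrite /x; lra.
have z1 : 1 <= expR x by apply: le_trans (expR_ge1Dx _); lra.
have z4 : expR x <= 4 by apply: le_trans (expR1_le4 R); rewrite ler_expR /x; lra.
apply: le_trans (Pr_long_cycle t _ mN2 ml z1) _; first by lia.
rewrite ler_wpM2l ?(ltW N0) //.
set M := #|edge n|; have M2 : (2 * M = n * 2 ^ n)%N := card_edge n.
have M2R : 2 * M%:R = n%:R * 2 ^+ n :> R by rewrite -natrX -!natrM M2.
have M0 : 0 < M%:R :> R.
  by rewrite -(pmulr_rgt0 _ (ltr0Sn R 1)) M2R mulr_gt0 //; lra.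
have mM : (m * n <= M)%N.
  by rewrite -(leq_pmul2l (ltn0Sn 1)) M2 mulnA mulnC leq_mul2l (ltnW mN2) orbT.
rewrite natrB //.
set y := t%:R / M%:R; set q := expR (- y); set eta := 2 * m%:R / 2 ^+ n : R.
have eta0 : 0 <= eta by rewrite divr_ge0 ?(ltW N0) ?mulr_ge0 ?ler0n.
have eta_n : eta * n%:R <= 2.
  rewrite /eta mulrAC ler_pdivrMr // -mulrA ler_wpM2l //.
  by rewrite -natrX -natrM ler_nat.
have eta5 : eta <= 1 / 5.
  by have := ler_wpM2l eta0 n0; lra.
have etaM : (m * n)%:R = eta * M%:R :> R.
  rewrite natrM; have two : 2 != 0 :> R by rewrite pnatr_eq0.
  apply: (mulfI two); rewrite [RHS]mulrCA M2R /eta.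
  by field; rewrite gt_eqF.
have y0 : 0 <= y by rewrite divr_ge0 ?ler0n.
have yn : n%:R * y <= 1 - x.
  rewrite /y mulrA ler_pdivrMr // /x.
  have -> : (1 - (1 - 2 * c)) * M%:R = c * (2 * M%:R) by ring.
  by rewrite M2R mulrCA ler_wpM2l // ler0n.
have np : 0 < n%:R :> R by exact: lt_le_trans n0.
have y1 : y <= n%:R^-1.
  rewrite -[leRHS]mul1r ler_pdivlMr // mulrC (le_trans yn) //.
  by rewrite lerBlDr lerDl.
have -> : t%:R / (M%:R - (m * n)%:R) = y / (1 - eta).
  have eta1 : 1 - eta != 0 by rewrite gt_eqF //; lra.
  by rewrite etaM -[X in X - _]mul1r -mulrBl /y invfM mulrA mulrAC.
have pE : y / (1 - eta) <= y * (1 + 2 * eta).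
  rewrite ler_wpM2l // -[leLHS]mul1r ler_pdivrMr; last by lra.
  by have := ler_wpM2l eta0 eta5; lra.
(* The base of the power [m * n], compared with an exponential through
   [1 + u <= exp u]. *)
have base : expR x * (y / (1 - eta)) + q
    <= expR (y * (expR x * (1 + 2 * eta) - 1 + n%:R^-1)).
  apply: le_trans (expR_ge1Dx _); have := expRN_le y0; rewrite -/q => qy.
  have : expR x * (y / (1 - eta)) <= expR x * (y * (1 + 2 * eta)).
    by rewrite ler_wpM2l ?expR_ge0.
  have : y ^+ 2 <= y * n%:R^-1 by rewrite expr2 ler_wpM2l.
  by move: qy; move: (expR x) (y / _) (n%:R^-1) => z p k *; lra.
have p0 : 0 <= expR x * (y / (1 - eta)) + q.
  by rewrite addr_ge0 ?expR_ge0 // mulr_ge0 ?expR_ge0 // divr_ge0 //; lra.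
apply: (@le_trans _ _ (expR (- x) ^+ m * (expR (y * (expR x * (1 + 2 * eta) - 1 + n%:R^-1))) ^+ (m * n))).
  rewrite expRN exprVn ler_wpM2l ?invr_ge0 ?exprn_ge0 ?expR_ge0 //.
  by rewrite lerXn2r ?nnegrE ?expR_ge0.
rewrite mulnC exprM -exprMn -expRM_natl -expRD -expRM_natl ler_expR -mulrN.
rewrite ler_wpM2l ?ler0n //.
set u := expR x * (1 + 2 * eta) - 1 + n%:R^-1.
have k0 : 0 < n%:R^-1 :> R by rewrite invr_gt0; lra.
have nk : n%:R * n%:R^-1 = 1 :> R by rewrite divff //; lra.
have u0 : 0 <= u.
  have := ler_pM ler01 eta0 z1 (lexx eta); rewrite /u; lra.
have : n%:R * (y * u) <= (1 - x) * u by rewrite mulrA ler_wpM2r.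
have etak : eta <= 2 * n%:R^-1 by rewrite ler_pdivlMr //; lra.
rewrite /cycle_rate.
have : (1 - x) * u <= (1 - x) * expR x - (1 - x) + 17 * n%:R^-1.
  have -> : (1 - x) * u = (1 - x) * expR x - (1 - x)
     + (1 - x) * (2 * (expR x * eta) + n%:R^-1) by rewrite /u; ring.
  rewrite lerD2l.
  have ze : expR x * eta <= 4 * (2 * n%:R^-1) by rewrite ler_pM ?expR_ge0.
  have x1 : 1 - x <= 1 by lra.
  have w0 : 0 <= 2 * (expR x * eta) + n%:R^-1.
    have := mulr_ge0 (expR_ge0 x) eta0; lra.
  apply: le_trans (ler_piMl w0 x1) _; lra.
lra.
Qed.

(** The function [(1 - y) * e ^ y + y ^ 2 / 2] has derivative [y * (1 - e ^ y)],
negative for [y > 0], and takes the value [1] at [0]. *)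
Lemma cycle_rate_gt (R : realType) (x : R) : 0 < x -> x ^+ 2 / 2 < cycle_rate x.
Proof.
move=> x0; pose h (y : R) : R := (1 - y) * expR y + y ^+ 2 / 2.
have dh : forall y : R, is_derive y (1 : R) h (y * (1 - expR y)).
  by move=> y; rewrite /h; apply: is_derive_eq; rewrite /GRing.scale /=; field.
have [|y /itvP y0x hx] := MVT x0 (fun y _ => dh y).
  apply: continuous_subspaceT => y.
  by apply/differentiable_continuous/derivable1_diffP; have [] := dh y.
have ey : 1 < expR y by rewrite expR_gt1 y0x.
have y0 : 0 < y by rewrite y0x.
have : y * (1 - expR y) * x < 0.
  by rewrite pmulr_llt0 // pmulr_rlt0 // subr_lt0.
rewrite -[X in _ * X]subr0 -hx /h /cycle_rate expR0.
by rewrite expr0n /=; lra.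
Qed.

(** * Conclusion *)

Lemma truncn_lt (R : realType) (a : R) (k n : nat) :
  (Num.truncn a + k < n)%N -> a < n%:R.
Proof.
move=> an; apply: lt_le_trans (truncnS_gt a) _.
by rewrite ler_nat; apply: leq_ltn_trans an; apply: leq_addr.
Qed.

Theorem theorem2p1 (R : realType) (c eps : R) :
  c < 1 / 2 -> 0 < eps ->
  exists n0 : nat, forall (n t : nat) (kappa : R),
    (n0 < n)%N ->
    t%:R <= c * 2 ^+ n ->
    2 * ln 2 / (1 - 2 * c) ^+ 2 <= kappa ->
    1 - eps * kappa `^ (- (3 / 2)) <
    Pr R (fun w : t.-tuple (edge n) =>
            #|long_cycle_vertices (sigma w) (kappa * n%:R)| == 0%N).
Proof.
move=> c2 eps0; set x := 1 - 2 * c.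
have x0 : 0 < x by rewrite /x; lra.
have x20 : 0 < x ^+ 2 by rewrite exprn_gt0.
pose delta := (cycle_rate x - x ^+ 2 / 2) / 2.
have d0 : 0 < delta by rewrite divr_gt0 // subr_gt0 cycle_rate_gt.
(* Half of the excess of the rate pays for the loss [17 / n], and the other half,
   [delta], for [eps] and for the power of [kappa]. *)
exists (Num.truncn (17 / delta) + (Num.truncn ((3 + `|ln eps|) / delta)
        + (Num.truncn (2 / x ^+ 2) + 10)))%N => n t kappa nbig tc kbig.
have n17 : 17 / delta < n%:R by exact: truncn_lt nbig.
have neps : (3 + `|ln eps|) / delta < n%:R.
  exact: truncn_lt (leq_ltn_trans (leq_addl _ _) nbig).
have nx : 2 / x ^+ 2 < n%:R.
  exact: truncn_lt (leq_ltn_trans (leq_trans (leq_addl _ _) (leq_addl _ _)) nbig).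
have n10 : (10 <= n)%N.
  by apply: ltnW; apply: leq_ltn_trans nbig; rewrite !addnA leq_addl.
have nR : 10 <= n%:R :> R by rewrite ler_nat.
have np : 0 < n%:R :> R by exact: lt_le_trans nR.
have N0 : 0 < 2 ^+ n :> R by rewrite exprn_gt0.
have c0 : 0 <= c by rewrite -(pmulr_lge0 _ N0) (le_trans _ tc) ?ler0n.
have ln2 : 1 / 2 <= ln 2 := ln2_ge_half R.
have ln2_le1 : ln 2 <= 1 :> R.
  by rewrite -ler_expR lnK ?posrE // (le_trans _ (expR_ge1Dx 1)).
have kx : ln 2 <= kappa * (x ^+ 2 / 2).
  by move: kbig; rewrite ler_pdivrMr //; move: (x ^+ 2) => x2; lra.
have x21 : x ^+ 2 <= 1 by rewrite expr_le1 ?(ltW x0) // /x; lra.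
have kp : 0 < kappa.
  by rewrite -(pmulr_lgt0 _ (divr_gt0 x20 (ltr0Sn R 1))); lra.
have k1 : 1 <= kappa.
  by have := ler_wpM2l (ltW kp) x21; lra.
have M0 : (0 < #|edge n|)%N.
  rewrite -(ltn_pmul2l (ltn0Sn 1)) card_edge muln0 muln_gt0 expn_gt0 andbT.
  exact: leq_trans n10.
rewrite (Pr_compl _ _ M0) ltrD2l ltrN2.
have target : eps * kappa `^ (- (3 / 2)) = expR (ln eps - 3 / 2 * ln kappa).
  by rewrite expRD lnK ?posrE // /powR gt_eqF // mulNr.
rewrite target.
(* No cycle is longer than the whole cube. *)
have [kN|kN] := ltP (2 ^+ n) kappa.
  rewrite PrE (_ : [set w | _] = set0) ?cards0 ?mul0r ?expR_gt0 //.
  apply/setP => w; rewrite !inE /=; apply/negbTE; rewrite negbK cards_eq0.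
  apply/eqP/setP => v.
  rewrite !inE; apply/negbTE; rewrite -leNgt.
  apply: (@le_trans _ _ (2 ^+ n)).
    rewrite -natrX ler_nat (leq_trans (max_card _)) //.
    by rewrite card_ffun card_bool card_ord.
  by apply: le_trans (ltW kN) _; rewrite ler_peMr ?(ltW kp) //; lra.
(* Capping [kappa] at [n] keeps [m <= n ^ 2], and since [kappa <= 2 ^ n] the cap
   still dominates [ln kappa]. *)
pose k := Num.min kappa n%:R.
have kn : k <= n%:R by rewrite ge_min lexx orbT.
have kk : k <= kappa by rewrite ge_min lexx.
have k1' : 1 <= k by rewrite le_min k1; lra.
have lnk : ln kappa <= k.
  rewrite le_min ltW ?ln_sublinear //=.
  apply: (@le_trans _ _ (ln (2 ^+ n))); first by rewrite ler_ln ?posrE.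
  by rewrite lnXn // -[leLHS]mulr_natl ler_piMr ?ler0n.
have kx' : ln 2 <= k * (x ^+ 2 / 2).
  rewrite /k minEle; case: ifP => // _.
  by move: nx; rewrite ltr_pdivrMr //; move: (x ^+ 2) => x2; lra.
clearbody k; pose m := Num.truncn (k * n%:R).
have mk : m%:R <= k * n%:R by rewrite truncn_le mulr_ge0 ?ler0n // (le_trans ler01).
have mk' : k * n%:R - 1 <= m%:R.
  by rewrite lerBlDr natr1 ltW // truncnS_gt.
have mn : (m <= n ^ 2)%N.
  by rewrite -(ler_nat R) (le_trans mk) // natrX expr2 ler_wpM2r ?ler0n //.
have ml : m%:R <= kappa * n%:R by rewrite (le_trans mk) // ler_wpM2r ?ler0n.
apply: le_lt_trans (Pr_long_cycle_exp c2 n10 tc mn ml) _; rewrite -/x.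
rewrite -[X in X ^+ n]lnK ?posrE // -expRM_natl -expRD ltr_expR.
have rate1 : cycle_rate x <= 1.
  by rewrite /cycle_rate lerBlDr lerDl mulr_ge0 ?expR_ge0 // /x; lra.
have n17d : 17 / n%:R <= delta.
  by rewrite ler_pdivrMr // mulrC -ler_pdivrMr // ltW.
have nd : 3 + `|ln eps| <= n%:R * delta by rewrite -ler_pdivrMr // ltW.
have leps := ler_norm (- ln eps); rewrite normrN in leps.
have s1 : x ^+ 2 / 2 + delta <= 1 by rewrite /delta; lra.
have rs : x ^+ 2 / 2 + delta <= cycle_rate x - 17 / n%:R by rewrite /delta in n17d *; lra.
have ms := ler_wpM2l (ler0n R m) rs.
have s0 : 0 <= x ^+ 2 / 2 + delta by rewrite (addr_ge0 _ (ltW d0)) // ltW // divr_gt0.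
have ms' := ler_wpM2r s0 mk'.
have kxn := ler_wpM2l (ltW np) kx'.
have kd : n%:R * delta - 3 / 2 <= k * (n%:R * delta - 3 / 2).
  by rewrite ler_peMl //; have := normr_ge0 (ln eps); lra.
move: ms ms' kxn kd s1 lnk leps nd; clearbody delta m.
move: (cycle_rate x - 17 / n%:R) (x ^+ 2 / 2) (ln kappa) (ln eps) => r a lk le.
by move: `|le| (ln 2) m%:R n%:R => *; lra.
Qed.
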